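(* Consider the convex quadratic program, for a given current state $x_0=x(k)\in\mathbb{R}^{n_x}$, $$\tilde J_T^* = \min_{\widetilde{\mathbf{\Phi}}_x,\widetilde{\mathbf{\Phi}}_u,\mathbf{\Sigma}} \tilde J_T(\widetilde{\mathbf{\Phi}}_x,\widetilde{\mathbf{\Phi}}_u)\qquad (\mathrm{QP})$$ over $\widetilde{\mathbf{\Phi}}_x\in\mathcal{L}_{TV}^{T,n_x\times n_x}$, $\widetilde{\mathbf{\Phi}}_u\in\mathcal{L}_{TV}^{T,n_u\times n_x}$ and $\mathbf{\Sigma}\in\mathcal{L}_{TV}^{T,n_x\times n_x}$ with the full filter parameterization ($\Sigma^{0,0}=I$; $\Sigma^{t,0}=\mathrm{diag}(d_{t-1})$ with $d_{t-1}\in\mathbb{R}^{n_x}$, $d_{t-1}>0$ entrywise, for $1\le t\le T$; all blocks strictly below the block diagonal are free), subject to: (a) $\begin{bmatrix} I-Z\hat{\mathbf{A}} & -Z\hat{\mathbf{B}}\end{bmatrix}\begin{bmatrix}\widetilde{\mathbf{\Phi}}_x\\ \widetilde{\mathbf{\Phi}}_u\end{bmatrix}=\mathbf{\Sigma}$; (b) for all vertices $(\Delta_A,\Delta_B)\in\{(\Delta_{A,j},\Delta_{B,j}) : 1\le j\le M\}$, all $i=1,\dots,n_x$ and all $t=0,\dots,T-1$, $$\big|e_i^\top(\Delta_A\tilde\Phi_x^{t,t}+\Delta_B\tilde\Phi_u^{t,t}-\Sigma^{t+1,t+1})x_0\big|+\sigma_{w,i}+\sum_{s=1}^{t}\big\|e_i^\top(\Delta_A\tilde\Phi_x^{t,t-s}+\Delta_B\tilde\Phi_u^{t,t-s}-\Sigma^{t+1,t+1-s})\big\|_1\le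 d_{t,i};$$ (c) $f^\top\tilde\Phi_x^{t,t}x_0+\sum_{s=1}^t\|f^\top\tilde\Phi_x^{t,t-s}\|_1\le b$ for all $(f,b)\in\mathrm{facet}(\mathcal{X})$, $t=0,\dots,T-1$; (d) $f^\top\tilde\Phi_x^{T,T}x_0+\sum_{s=1}^T\|f^\top\tilde\Phi_x^{T,T-s}\|_1\le b$ for all $(f,b)\in\mathrm{facet}(\mathcal{X}_T)$; (e) $f^\top\tilde\Phi_u^{t,t}x_0+\sum_{s=1}^t\|f^\top\tilde\Phi_u^{t,t-s}\|_1\le b$ for all $(f,b)\in\mathrm{facet}(\mathcal{U})$, $t=0,\dots,T-1$; where the cost is $$\tilde J_T(\widetilde{\mathbf{\Phi}}_x,\widetilde{\mathbf{\Phi}}_u)=\left\|\begin{bmatrix}\mathbf{Q}^{1/2}&\\&\mathbf{R}^{1/2}\end{bmatrix}\begin{bmatrix}\widetilde{\mathbf{\Phi}}_x(:,0)\\ \widetilde{\mathbf{\Phi}}_u(:,0)\end{bmatrix}x_0\right\|_2^2,$$ with $\mathbf{Q}=\mathrm{blkdiag}(Q,\dots,Q,Q_T)$ and $\mathbf{R}=\mathrm{blkdiag}(R,\dots,R,0)$ (each with $T+1$ diagonal blocks). Then: 1. For any feasible solution $\{\widetilde{\mathbf{\Phi}}_x,\widetilde{\mathbf{\Phi}}_u,\mathbf{\Sigma}\}$ of (QP), the linear time-varying state feedback controller $\mathbf{u}=\mathbf{K}\mathbf{x}$ with $\mathbf{K}=\widetilde{\mathbf{\Phi}}_u\widetilde{\mathbf{\Phi}}_x^{-1}$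 is feasible for the robust optimal control problem (robust OCP) defined in the context. 2. With the additional structural constraint $\Sigma^{t,t}=0$ for $t=1,\dots,T$ on the filter, the optimal cost of (QP) is an upper bound on the optimal cost $J_T^*$ of the robust OCP.
   Context: **Block matrices.** For a horizon $T\ge 1$, $\mathcal{L}_{TV}^{T,p\times q}$ is the set of block-lower-triangular matrices $\mathbf{R}$ with $(T+1)\times(T+1)$ blocks of size $p\times q$, where the block in block-row $i$ and block-column $j$ ($0\le j\le i\le T$, indexed from $0$) is denoted $R^{i,i-j}$. Thus $R^{t,0}$ are the diagonal blocks and $R^{t,t}$ is the block in row $t$, column $0$. $\mathbf{R}(:,j)$ denotes the $j$-th block column. Blocks of $\widetilde{\mathbf{\Phi}}_x,\widetilde{\mathbf{\Phi}}_u,\mathbf{\Sigma}$ are written $\tilde\Phi_x^{i,j},\tilde\Phi_u^{i,j},\Sigma^{i,j}$. $Z$ is the block-downshift matrix (identity blocks $I_{n_x}$ on the first block sub-diagonal, zero elsewhere). $\hat{\mathbf{A}}=\mathrm{blkdiag}(\hat A,\dots,\hat A)$, $\hat{\mathbf{B}}=\mathrm{blkdiag}(\hat B,\dots,\hat B)$ with $T+1$ blocks. $e_i$ is the $i$-th standard basis vector of $\mathbb{R}^{n_x}$; $d_{t,i}$ is the $i$-th entry of $d_t$. **Uncertain system.** $x_{t+1}=(\hat A+\Delta_A)x_t+(\hat B+\Delta_B)u_t+w_t$ with $x_t\in\mathbb{R}^{n_x}$, $u_t\in\mathbb{R}^{n_u}$, known $(\hat A,\hat B)$, unknown $(\Delta_A,\Delta_B)\in\mathcal{P}:=\mathrm{Conv}\{(\Delta_{A,1},\Delta_{B,1}),\dots,(\Delta_{A,M},\Delta_{B,M})\}$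 (the same $(\Delta_A,\Delta_B)$ at all times of the horizon), and $w_t\in\mathcal{W}$, where $\mathcal{W}\subset\mathbb{R}^{n_x}$ is a (nonempty) polytope. With $h_{\mathcal{W}}(c)=\max_{w\in\mathcal{W}}c^\top w$, set $\sigma_{w,i}=\max\{h_{\mathcal{W}}(e_i),h_{\mathcal{W}}(-e_i)\}$. **Constraints.** $\mathcal{X}=\{x: F_xx\le b_x\}$, $\mathcal{U}=\{u:F_uu\le b_u\}$, $\mathcal{X}_T=\{x:F_Tx\le b_T\}$ are compact polytopes containing the origin in their interior. $\mathrm{facet}(\mathcal{X})$ is the set of pairs $(f,b)$ where $f^\top$ is a row of $F_x$ and $b$ the corresponding entry of $b_x$; likewise for $\mathcal{U}$ and $\mathcal{X}_T$. **Controllers.** A causal linear time-varying (LTV) state feedback controller is $\mathbf{K}\in\mathcal{L}_{TV}^{T,n_u\times n_x}$, acting as $\mathbf{u}=\mathbf{K}\mathbf{x}$ with $\mathbf{x}=(x_0,\dots,x_T)$, $\mathbf{u}=(u_0,\dots,u_T)$, i.e. $u_t=\pi_t(x_{0:t})=\sum_{i=0}^tK^{t,t-i}x_i$. **Robust OCP.** Minimize $J_T(\pi)$ over causal LTV state feedback policies $\pi=\pi_{0:T-1}$ such that, with $x_0=x(k)$, $u_t=\pi_t(x_{0:t})$ and the uncertain dynamics above, one has $x_t\in\mathcal{X}$, $u_t\in\mathcal{U}$ for $t=0,\dots,T-1$ and $x_T\in\mathcal{X}_T$, for all $(\Delta_A,\Delta_B)\in\mathcal{P}$ and all $w_0,\dots,w_{T-1}\in\mathcal{W}$.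 The cost is the nominal cost $J_T(\pi)=\sum_{t=0}^{T-1}(\hat x_t^\top Q\hat x_t+u_t^\top Ru_t)+\hat x_T^\top Q_T\hat x_T$, evaluated along $\hat x_0=x(k)$, $\hat x_{t+1}=\hat A\hat x_t+\hat Bu_t$, $u_t=\pi_t(\hat x_{0:t})$, with $Q\succeq0$, $R\succ0$, $Q_T\succeq0$. Its optimal value is $J_T^*$. A controller is feasible for the robust OCP if its policy satisfies these robust constraints. Optimal costs are understood as infima, equal to $+\infty$ for infeasible problems. *)

(* Defs.v *)
From HB Require Import structures.
From mathcomp Require Import all_boot all_order all_algebra.
From mathcomp Require Import all_classical all_reals all_analysis.

Set Implicit Arguments.
Unset Strict Implicit.
Unset Printing Implicit Defensive.

Import Order.TTheory GRing.Theory Num.Theory.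
Import numFieldNormedType.Exports.

Local Open Scope classical_set_scope.
Local Open Scope ring_scope.

Section Generic.
Variable R : realType.

Definition conv_hull (V : lmodType R) (N : nat) (v : 'I_N -> V) : set V :=
  [set x | exists a : 'I_N -> R,
     [/\ forall j, 0 <= a j, \sum_j a j = 1 & x = \sum_j a j *: v j]].

Definition polytope (V : lmodType R) (S : set V) : Prop :=
  exists (N : nat) (v : 'I_N -> V), S = conv_hull v.

Definition polyhedron m n (F : 'M[R]_(m, n)) (b : 'cV[R]_m) : set 'cV[R]_n :=
  [set x | forall i, (F *m x) i 0 <= b i 0].

Definition facet m n (F : 'M[R]_(m, n)) (b : 'cV[R]_m) :
    set ('cV[R]_n * R) :=
  [set ((row i F)^T, b i 0) | i in [set: 'I_m]].

Definition psdmx n (A : 'M[R]_n) : Prop :=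
  A^T = A /\ forall x : 'cV[R]_n, 0 <= (x^T *m A *m x) 0 0.

Definition pdmx n (A : 'M[R]_n) : Prop :=
  A^T = A /\ forall x : 'cV[R]_n, x != 0 -> 0 < (x^T *m A *m x) 0 0.

(* The positive semidefinite square root (unique, and existing whenever A is
   positive semidefinite; the default value 0 is then never used). *)
Definition mxsqrt n (A : 'M[R]_n) : 'M[R]_n :=
  xget 0 [set S : 'M[R]_n | psdmx S /\ S *m S = A].

Definition l1norm n (v : 'rV[R]_n) : R := \sum_j `|v 0 j|.
Definition l2norm n (v : 'cV[R]_n) : R := Num.sqrt (\sum_i v i 0 ^+ 2).

(* The support function of S; the supremum is a maximum when S is a nonempty
   polytope. *)
Definition supp n (S : set 'cV[R]_n) (c : 'cV[R]_n) : R :=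
  sup [set (c^T *m w) 0 0 | w in S].

Definition e_ n (i : 'I_n) : 'cV[R]_n := delta_mx i 0.

(* The infimum of J over S in the extended reals: +oo if S is empty. *)
Definition optimal_cost (V : Type) (J : V -> R) (S : set V) : \bar R :=
  ereal_inf [set (J v)%:E | v in S].

End Generic.

Section BlockMatrices.
Variables (R : realType) (T : nat).

Definition blkmx (p q : nat) : Type :=
  'M[R]_((\sum_(i < T.+1) p)%N, (\sum_(j < T.+1) q)%N).

(* [blk M i k] is M^{i,k}: the block in block-row i and block-column i - k.  It
   is meant for k <= i <= T only. *)
Definition blk p q (M : blkmx p q) (i k : nat) : 'M[R]_(p, q) :=
  @submxblock R T.+1 T.+1 (fun=> p) (fun=> q) M (inord i) (inord (i - k)).

Definition LTV p q : set (blkmx p q) :=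
  [set M | forall i j : 'I_T.+1, (i < j)%N ->
     @submxblock R T.+1 T.+1 (fun=> p) (fun=> q) M i j = 0].

Definition col0 p q (M : blkmx p q) : 'M[R]_((\sum_(i < T.+1) p)%N, q) :=
  @submxrow R T.+1 (fun=> q) _ M ord0.

Definition downshift n : blkmx n n :=
  \mxblock_(i < T.+1, j < T.+1) (if i == j.+1 :> nat then 1%:M else 0 : 'M[R]_n).

(* \mxdiag is restricted to square blocks, and blkdiag(B, ..., B) has
   rectangular ones. *)
Definition blkdiag p q (A : 'M[R]_(p, q)) : blkmx p q :=
  \mxblock_(i < T.+1, j < T.+1) (if i == j then A else 0).

Definition blkdiag_last n (A A' : 'M[R]_n) : blkmx n n :=
  \mxdiag_(i < T.+1) (if i == T :> nat then A' else A).

End BlockMatrices.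

(* The data of the robust optimal control problem; the constraint polytopes
   have kx, ku and kT inequalities, and [Delta j] is the j-th vertex of the
   model uncertainty set. *)
Record rocp (R : realType) (nx nu M kx ku kT : nat) := Rocp {
  Ahat : 'M[R]_nx;
  Bhat : 'M[R]_(nx, nu);
  Delta : 'I_M -> 'M[R]_nx * 'M[R]_(nx, nu);
  Wset : set 'cV[R]_nx;
  Fx : 'M[R]_(kx, nx);
  bx : 'cV[R]_kx;
  Fu : 'M[R]_(ku, nu);
  bu : 'cV[R]_ku;
  FT : 'M[R]_(kT, nx);
  bT : 'cV[R]_kT;
  Qx : 'M[R]_nx;
  Ru : 'M[R]_nu;
  QT : 'M[R]_nx;
  x0 : 'cV[R]_nx
}.

Section Trajectories.
Variables (R : realType) (nx nu : nat).

(* A policy at time t maps the history [:: x_0; ...; x_t] to u_t. *)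
Definition policy : Type := nat -> seq 'cV[R]_nx -> 'cV[R]_nu.

Definition ltv_policy T (K : blkmx R T nu nx) : policy :=
  fun t h => \sum_(0 <= i < t.+1) blk K t (t - i) *m h`_i.

Variables (A : 'M[R]_nx) (B : 'M[R]_(nx, nu)) (w : nat -> 'cV[R]_nx).
Variables (xinit : 'cV[R]_nx) (pi : policy).

(* The history [:: x_0; ...; x_t] of the closed loop
   x_{t+1} = A x_t + B u_t + w_t, u_t = pi_t(x_{0:t}), x_0 = xinit. *)
Fixpoint history (t : nat) : seq 'cV[R]_nx :=
  if t is s.+1 then
    let h := history s in
    rcons h (A *m last 0 h + B *m pi s h + w s)
  else [:: xinit].

Definition state (t : nat) : 'cV[R]_nx := last 0 (history t).
Definition input (t : nat) : 'cV[R]_nu := pi t (history t).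

End Trajectories.

Section Problems.
Variables (R : realType) (nx nu T M kx ku kT : nat).
Variable p : rocp R nx nu M kx ku kT.

Definition Xset := polyhedron (Fx p) (bx p).
Definition Uset := polyhedron (Fu p) (bu p).
Definition XTset := polyhedron (FT p) (bT p).

Definition Pset : set ('M[R]_nx * 'M[R]_(nx, nu)) := conv_hull (Delta p).

Definition sigma_w (i : 'I_nx) : R :=
  Num.max (supp (Wset p) (e_ R i)) (supp (Wset p) (- e_ R i)).

Definition robustly_feasible (pi : policy R nx nu) : Prop :=
  forall DA DB (w : nat -> 'cV[R]_nx),
    Pset (DA, DB) -> (forall t, (t < T)%N -> Wset p (w t)) ->
    let x := state (Ahat p + DA) (Bhat p + DB) w (x0 p) pi in
    let u := input (Ahat p + DA) (Bhat p + DB) w (x0 p) pi in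
    (forall t, (t < T)%N -> Xset (x t) /\ Uset (u t)) /\ XTset (x T).

Definition JT (pi : policy R nx nu) : R :=
  let x := state (Ahat p) (Bhat p) (fun=> 0) (x0 p) pi in
  let u := input (Ahat p) (Bhat p) (fun=> 0) (x0 p) pi in
  \sum_(0 <= t < T) (((x t)^T *m Qx p *m x t) 0 0 +
                     ((u t)^T *m Ru p *m u t) 0 0) +
  ((x T)^T *m QT p *m x T) 0 0.

(* The last block row of K, which would define u_T, is irrelevant here. *)
Definition ocp_feasible (K : blkmx R T nu nx) : Prop :=
  LTV K /\ robustly_feasible (ltv_policy K).

Definition JT_opt : \bar R :=
  optimal_cost (fun K : blkmx R T nu nx => JT (ltv_policy K))
    [set K | ocp_feasible K].

Record qp_vars := QpVars {
  Phx : blkmx R T nx nx;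
  Phu : blkmx R T nu nx;
  Sig : blkmx R T nx nx
}.

(* [d t] is the diagonal of Sigma^{t+1,0}; for t < T it is determined by Sig. *)
Definition qp_filter (v : qp_vars) (d : nat -> 'cV[R]_nx) : Prop :=
  [/\ LTV (Sig v), blk (Sig v) 0 0 = 1%:M &
      forall t, (1 <= t <= T)%N ->
        blk (Sig v) t 0 = diag_mx (d t.-1)^T /\ forall i, 0 < d t.-1 i 0].

Definition qp_affine (v : qp_vars) : Prop :=
  let Z := downshift R T nx in
  row_mx (1%:M - Z *m blkdiag T (Ahat p)) (- (Z *m blkdiag T (Bhat p)))
    *m col_mx (Phx v) (Phu v) = Sig v.

Definition qp_overbound (v : qp_vars) (d : nat -> 'cV[R]_nx) : Prop :=
  forall (j : 'I_M) (i : 'I_nx) (t : nat), (t < T)%N ->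
    let E s := (Delta p j).1 *m blk (Phx v) t (t - s)
             + (Delta p j).2 *m blk (Phu v) t (t - s)
             - blk (Sig v) t.+1 (t.+1 - s) in
    `| ((e_ R i)^T *m E 0%N *m x0 p) 0 0 | + sigma_w i
      + \sum_(1 <= s < t.+1) l1norm ((e_ R i)^T *m E s) <= d t i 0.

Definition qp_tightened m n (F : 'M[R]_(m, n)) (b : 'cV[R]_m)
    (Phi : blkmx R T n nx) (t : nat) : Prop :=
  forall fb, facet F b fb ->
    (fb.1^T *m blk Phi t t *m x0 p) 0 0
      + \sum_(1 <= s < t.+1) l1norm (fb.1^T *m blk Phi t (t - s)) <= fb.2.

Definition qp_feasible (v : qp_vars) : Prop :=
  [/\ LTV (Phx v), LTV (Phu v) & exists d : nat -> 'cV[R]_nx,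
    [/\ qp_filter v d, qp_affine v & qp_overbound v d]] /\
  [/\ forall t, (t < T)%N -> qp_tightened (Fx p) (bx p) (Phx v) t,
      qp_tightened (FT p) (bT p) (Phx v) T &
      forall t, (t < T)%N -> qp_tightened (Fu p) (bu p) (Phu v) t].

Definition qp_cost (v : qp_vars) : R :=
  l2norm (block_mx (mxsqrt (blkdiag_last T (Qx p) (QT p))) 0
                   0 (mxsqrt (blkdiag_last T (Ru p) 0))
          *m col_mx (col0 (Phx v)) (col0 (Phu v)) *m x0 p) ^+ 2.

Definition zero_first_column (v : qp_vars) : Prop :=
  forall t, (1 <= t <= T)%N -> blk (Sig v) t t = 0.

End Problems.

(* Main.v *)
(** Along a closed-loop trajectory put [y = Phx^-1 x], so that [x = Phx y],
    [u = Phu y] and [y_0 = x_0].  Constraint (a) then reads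
      [diag(d_t) y_{t+1} = w_t + DA x_t + DB u_t
                           - sum_(s <= t) Sig^{t+1,t+1-s} y_s],
    and (b), being preserved by convex combinations of the vertices of the
    uncertainty set, yields [|y_{t+1}| <= 1] entrywise by induction on [t].
    Hoelder's inequality turns (c)-(e) into the constraints of the robust
    problem.  If moreover the first block column of [Sig] vanishes below the
    diagonal, the nominal [y_t] is [0] for [t >= 1], so the nominal trajectory
    is the first block column of [(Phx, Phu)] times [x_0], and both costs agree. *)

Require Import Defs.
From HB Require Import structures.
From mathcomp Require Import all_boot all_order all_algebra.
From mathcomp Require Import all_classical all_reals all_analysis.
From mathcomp Require Import complex lra.
Import Order.TTheory GRing.Theory Num.Theory.
Import numFieldNormedType.Exports.
Local Open Scope classical_set_scope.
Local Open Scope ring_scope.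

Set Implicit Arguments.
Unset Strict Implicit.

(** * Square roots of positive semidefinite matrices *)

Lemma interpolation_exists (F : fieldType) (s : seq F) (g : F -> F) :
  exists q : {poly F}, forall a, a \in s -> q.[a] = g a.
Proof.
elim: s => [|a s [q qP]]; first by exists 0.
case: (boolP (a \in s)) => [sa|sa].
  by exists q => b; rewrite inE => /predU1P[->|]; exact: qP.
(* [r] vanishes on [s] and not at [a], so a multiple of it corrects the value at [a] without
   disturbing the values on [s]. *)
set r := \prod_(b <- s) ('X - b%:P).
have r0 : r.[a] != 0 by rewrite -/(root r a) root_prod_XsubC.
exists (q + ((g a - q.[a]) / r.[a]) *: r) => b.
rewrite hornerD hornerZ inE => /predU1P[->|sb]; first by rewrite divfK // addrC subrK.
have /eqP -> : root r b by rewrite root_prod_XsubC.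
by rewrite mulr0 addr0 qP.
Qed.

Lemma trmx_horner_mx (F : comNzRingType) n (A : 'M[F]_n.+1) (q : {poly F}) :
  (horner_mx A q)^T = horner_mx A^T q.
Proof.
elim/poly_ind: q => [|q c IH]; first by rewrite !rmorph0 trmx0.
rewrite !rmorphD !rmorphM /= !horner_mx_X !horner_mx_C linearD /= tr_scalar_mx.
by rewrite trmx_mul IH [A^T *m _]comm_mx_horner.
Qed.

(* The entries of A being real, A is diagonalizable over the complexification
   of R; its eigenvalues are real by symmetry, and nonnegative. *)
Lemma psdmx_annihilator (R : realType) n (A : 'M[R]_n.+1) : psdmx A ->
  exists s : seq R, (forall a, a \in s -> 0 <= a) /\
    forall q : {poly R}, (forall a, a \in s -> root q a) -> horner_mx A q = 0.
Proof.
move=> [Asym Apos].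
pose C : numClosedFieldType := complex R.
pose f : {rmorphism R -> C} := @complex.real_complex_def R (Phant R).
pose A' := map_mx f A.
have A'real : A' \is a mxOver Num.real.
  by apply/mxOverP => i j; rewrite mxE; apply/complex.complex_realP; exists (A i j).
have A'h : A' \is hermitianmx n.+1 false Num.conj.
  apply: realsym_hermsym => //; apply/is_hermitianmxP.
  by rewrite expr0 scale1r map_mx_id // map_trmx Asym.
have /orthomx_spectralP AE := hermitian_normalmx A'h.
have dreal := hermitian_spectral_diag_real A'h.
have Pu := spectral_unit A'.
set P := spectralmx A' in AE Pu; set d := spectral_diag A' in AE dreal.
pose l (i : 'I_n.+1) := complex.Re (d 0 i).
have dE i : d 0 i = f (l i).
  have /mxOverP/(_ 0 i) /complex.RRe_real <- := dreal.
  by [].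
(* The witness lists the eigenvalues of [A], read off the complex spectral diagonal. *)
exists [seq l i | i <- enum 'I_n.+1]; split.
  move=> _ /mapP[i _ ->].
  (* Row [i] of [P] is a complex eigenvector; [eigenvalue_map] descends the eigenvalue to [R], where
     a real eigenvector [v] can be tested against the quadratic form. *)
  have /eigenvalueP[v vA v0] : eigenvalue A (l i).
    rewrite -(eigenvalue_map f) -dE; apply/eigenvalueP; exists (row i P).
      rewrite -/A' AE !mulmxA -row_mul mulmxV // row1 -rowE row_diag_mx.
      by rewrite -scalemxAl -rowE.
    apply/eqP => /(congr1 (mulmx^~ (invmx P))).
    rewrite -row_mul mulmxV // mul0mx row1 => /matrixP/(_ 0 i)/eqP.
    by rewrite !mxE !eqxx oner_eq0.
  have := Apos v^T; rewrite trmxK vA -scalemxAl mxE.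
  suff v2 : 0 < (v *m v^T) 0 0 by rewrite pmulr_lge0.
  have v2E : (v *m v^T) 0 0 = \sum_j v 0 j ^+ 2.
    by rewrite mxE; apply: eq_bigr => j _; rewrite mxE expr2.
  rewrite v2E lt_neqAle sumr_ge0 ?andbT; last by move=> j _; exact: sqr_ge0.
  apply: contra v0 => /eqP/esym/psumr_eq0P H; apply/eqP/rowP => j; rewrite mxE.
  by apply/eqP; rewrite -sqrf_eq0 H // => k _; exact: sqr_ge0.
(* Over the complex numbers, [q(A)] is similar to the diagonal matrix of the values [q(l i)], all
   zero. *)
move=> q qs; apply: (map_mx_inj (f := f)).
rewrite map_horner_mx -/A' AE horner_mx_uconjC // horner_mx_diag map_mx0.
suff -> : map_mx (horner (map_poly f q)) d = 0 by rewrite linear0 mulmx0 mul0mx.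
apply/rowP => i; rewrite !mxE dE horner_map.
have /eqP -> : root q (l i) by apply/qs/map_f; rewrite mem_enum.
by rewrite rmorph0.
Qed.

(** The root is [r(A)^2], where the polynomial [r] interpolates the fourth root on the spectrum:
    [r(A)] is symmetric, so its square is positive semidefinite, and [r^4 - X] vanishes on the
    spectrum. *)
Lemma psdmx_sqrt_exists (R : realType) n (A : 'M[R]_n) : psdmx A ->
  exists S : 'M[R]_n, psdmx S /\ S *m S = A.
Proof.
case: n A => [|n] A psdA.
  by exists A; split => //; rewrite flatmx0 [RHS]flatmx0.
have [s [s_ge0 sA]] := psdmx_annihilator psdA.
have [r rP] := interpolation_exists s (fun a => Num.sqrt (Num.sqrt a)).
have Asym := psdA.1.
have rsym : (horner_mx A r)^T = horner_mx A r by rewrite trmx_horner_mx Asym.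
exists (horner_mx A (r ^+ 2)); split; first split.
- by rewrite trmx_horner_mx Asym.
- move=> x; rewrite rmorphXn /= expr2 -mulmxE.
  rewrite -{1}rsym !mulmxA -trmx_mul -mulmxA mxE sumr_ge0 // => j _.
  by rewrite mxE -expr2 sqr_ge0.
have := sA ((r ^+ 2) ^+ 2 - 'X).
rewrite rmorphB /= horner_mx_X => H; apply/eqP; rewrite -subr_eq0.
have <- : horner_mx A ((r ^+ 2) ^+ 2) = horner_mx A (r ^+ 2) *m horner_mx A (r ^+ 2).
  by rewrite [in LHS]expr2 rmorphM.
rewrite H // => a sa; rewrite rootE hornerD hornerN hornerX !horner_exp rP //.
by rewrite !sqr_sqrtr ?sqrtr_ge0 ?s_ge0 // subrr.
Qed.

Lemma mxsqrtP (R : realType) n (A : 'M[R]_n) : psdmx A ->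
  psdmx (mxsqrt A) /\ mxsqrt A *m mxsqrt A = A.
Proof.
by move=> /psdmx_sqrt_exists [S SP]; rewrite /mxsqrt; case: xgetP => [? -> //|/(_ S)].
Qed.

(** * Algebra of block-lower-triangular matrices *)

Section BlockAlgebra.
Variables (R : realType) (T : nat).

(** Indexed by block row and block column, whereas the second index of [blk] counts block
    subdiagonals. *)
Definition block p q (M : blkmx R T p q) (i j : 'I_T.+1) : 'M[R]_(p, q) :=
  @submxblock R T.+1 T.+1 (fun=> p) (fun=> q) M i j.

(** The index is a natural number because it is read as a time; it is meaningful up to [T]. *)
Definition block_row p m (y : 'M[R]_((\sum_(i < T.+1) p)%N, m)) (i : nat) :
    'M[R]_(p, m) :=
  @submxcol R T.+1 (fun=> p) m y (inord i).

Definition block_col p m (V : 'M[R]_(m, (\sum_(i < T.+1) p)%N)) (j : 'I_T.+1) :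
    'M[R]_(m, p) :=
  @submxrow R T.+1 (fun=> p) m V j.

Lemma blkE p q (M : blkmx R T p q) t s : (s <= t)%N ->
  blk M t (t - s) = block M (inord t) (inord s).
Proof. by move=> st; rewrite /blk subKn. Qed.

Lemma block_col_row p q (M : blkmx R T p q) i j :
  block_col (block_row M i) j = block M (inord i) j.
Proof. by rewrite /block submxblockEv. Qed.

Lemma row_col_block p q (M : blkmx R T p q) i j :
  block_row (block_col M j) i = block M (inord i) j.
Proof. by rewrite /block submxblockEh. Qed.

Lemma mxcol_block_row p m (y : 'M[R]_(_, m)) :
  @mxcol R T.+1 (fun=> p) m (fun i => block_row y i) = y.
Proof.
rewrite -[RHS](@submxcolK R T.+1 (fun=> p)); apply: eq_mxcol => i.
by rewrite /block_row inord_val.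
Qed.

Lemma block_row_mul p q m (M : blkmx R T p q) (y : 'M[R]_(_, m)) t :
  block_row (M *m y) t = \sum_(s < T.+1) block M (inord t) s *m block_row y s.
Proof.
rewrite -{1}[y]mxcol_block_row -[M in LHS](@submxblockK R T.+1 T.+1 (fun=> p) (fun=> q)).
by rewrite mul_mxblock_mxrow /block_row mxcolK.
Qed.

Lemma block_row_LTV_mul p q m (M : blkmx R T p q) (y : 'M[R]_(_, m)) t :
  LTV M -> (t <= T)%N ->
  block_row (M *m y) t = \sum_(0 <= s < t.+1) blk M t (t - s) *m block_row y s.
Proof.
move=> LM tT; rewrite block_row_mul.
(* Extending the summand to natural numbers lets the sum be cut after index [t]; the tail lies above
   the block diagonal. *)
pose F s := block M (inord t) (inord s) *m block_row y s.
transitivity (\sum_(s < T.+1) F s).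
  by apply: eq_bigr => s _; rewrite /F inord_val.
rewrite -(big_mkord predT F) (big_cat_nat (n := t.+1)) //=.
rewrite [X in _ + X]big_nat_cond [X in _ + X]big1 ?addr0; last first.
  move=> s /andP[/andP[ts sT] _]; rewrite /F [block _ _ _]LM ?mul0mx //.
  by rewrite !inordK.
by apply: eq_big_nat => s /andP[_ st]; rewrite blkE.
Qed.

Lemma block_col_mul p m (V : 'M[R]_(m, _)) (M : blkmx R T p p) j :
  block_col (V *m M) j = \sum_(k < T.+1) block_col V k *m block M k j.
Proof.
rewrite -[V in LHS](@submxrowK R T.+1 (fun=> p)).
rewrite -[M in LHS](@submxblockK R T.+1 T.+1 (fun=> p) (fun=> p)).
by rewrite mul_mxrow_mxblock /block_col mxrowK.
Qed.

(* Back substitution, from the last block column. *)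
Lemma LTV_mul_block_col_eq0 p m (V : 'M[R]_(m, _)) (M : blkmx R T p p) (i : nat) :
  LTV M -> (forall j, block M j j \in unitmx) ->
  (forall j : 'I_T.+1, (i <= j)%N -> block_col (V *m M) j = 0) ->
  forall j : 'I_T.+1, (i <= j)%N -> block_col V j = 0.
Proof.
move=> LM Mu VM j.
have [n] := ubnP (T - j); elim: n j => // n IH j jn ij.
have := VM j ij; rewrite block_col_mul (bigD1 j) //= big1 ?addr0 => [H|k kj].
  by rewrite -[LHS](mulmxK (Mu j)) H mul0mx.
(* Terms with [k > j] vanish by induction, those with [k < j] by triangularity of [M]. *)
have [jk|/ltnW kj'|/val_inj kE] := ltngtP j k; last by rewrite kE eqxx in kj.
  rewrite IH ?mul0mx ?(leq_trans ij (ltnW jk)) //.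
  by rewrite (@leq_trans (T - j)) // ltn_sub2l // (leq_trans jk) // -ltnS.
rewrite [block _ _ _]LM ?mulmx0 // ltn_neqAle kj' andbT.
by apply: contra kj => /eqP/val_inj ->.
Qed.

(** Back substitution over all block columns shows that the left kernel is zero. *)
Lemma LTV_unitmx p (M : blkmx R T p p) :
  LTV M -> (forall j, block M j j \in unitmx) -> M \in unitmx.
Proof.
move=> LM Mu; rewrite -row_free_unit -kermx_eq0; apply/eqP.
apply/(@mxrowP _ _ (fun=> p)) => j; rewrite submxrow0.
apply: (LTV_mul_block_col_eq0 (i := 0) LM Mu) => // k _.
by rewrite mulmx_ker /block_col submxrow0.
Qed.

(** Block row [i] of [N *m invmx M], multiplied by [M], is block row [i] of [N], which vanishes
    beyond column [i]; back substitution down to column [i.+1] concludes. *)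
Lemma LTV_mul_invmx p q (N : blkmx R T q p) (M : blkmx R T p p) :
  LTV N -> LTV M -> (forall j, block M j j \in unitmx) -> LTV (N *m invmx M).
Proof.
move=> LN LM Mu i j ij.
rewrite -(inord_val i) -/(block _ _ _) -block_col_row.
apply: (LTV_mul_block_col_eq0 (i := i.+1) LM Mu) => // k ik.
rewrite /block_row submxcol_mul mulmxKV ?LTV_unitmx //.
by rewrite -/(block_row _ _) block_col_row inord_val [block _ _ _]LN.
Qed.

Lemma block_row_blkdiag p q m (A : 'M[R]_(p, q)) (y : 'M[R]_(_, m)) t :
  (t <= T)%N -> block_row (blkdiag T A *m y) t = A *m block_row y t.
Proof.
move=> tT; rewrite block_row_mul (bigD1 (inord t)) //= big1 ?addr0.
  by rewrite /block mxblockK eqxx inordK.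
by move=> s st; rewrite /block mxblockK eq_sym (negPf st) mul0mx.
Qed.

Lemma block_row_downshiftS n m (y : 'M[R]_(_, m)) t : (t < T)%N ->
  block_row (downshift R T n *m y) t.+1 = block_row y t.
Proof.
move=> tT; rewrite block_row_mul (bigD1 (inord t)) //= big1 ?addr0.
  rewrite /block mxblockK !inordK ?ltnS ?eqxx ?mul1mx //; exact: ltnW.
move=> s st; rewrite /block mxblockK inordK // eqSS.
case: eqP => [tE|_]; last by rewrite mul0mx.
by move: st; rewrite tE inord_val eqxx.
Qed.

Lemma block_row_downshift0 n m (y : 'M[R]_(_, m)) :
  block_row (downshift R T n *m y) 0 = 0.
Proof.
by rewrite block_row_mul big1 // => s _; rewrite /block mxblockK inordK ?mul0mx.
Qed.

Lemma block_rowB p m (y z : 'M[R]_(_, m)) t :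
  @block_row p m (y - z) t = block_row y t - block_row z t.
Proof. exact: submxcolB. Qed.

End BlockAlgebra.

(** * Closed-loop trajectories as system responses *)

Section ClosedLoop.
Variables (R : realType) (nx nu T : nat).
Variables (A : 'M[R]_nx) (B : 'M[R]_(nx, nu)) (w : nat -> 'cV[R]_nx).
Variables (xinit : 'cV[R]_nx).

Lemma size_history (pi : policy R nx nu) t :
  size (history A B w xinit pi t) = t.+1.
Proof. by elim: t => //= t IH; rewrite size_rcons IH. Qed.

Lemma nth_history (pi : policy R nx nu) t i : (i <= t)%N ->
  (history A B w xinit pi t)`_i = state A B w xinit pi i.
Proof.
elim: t => [|t IH]; first by rewrite leqn0 => /eqP ->.
rewrite leq_eqVlt => /predU1P[->|it].
  by rewrite /state -nth_last size_history; apply: set_nth_default; rewrite size_history.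
by rewrite /= nth_rcons size_history it IH.
Qed.

Lemma stateS (pi : policy R nx nu) t :
  state A B w xinit pi t.+1 =
  A *m state A B w xinit pi t + B *m input A B w xinit pi t + w t.
Proof. by rewrite {1}/state /= last_rcons. Qed.

(** Stacking the states into [xs], take [y = invmx Px *m xs]. The gain is block lower triangular, so
    block row [t] of [Pu *m y] reads only the states up to time [t], as the policy does. The
    dynamics are arbitrary, to cover both the uncertain and the nominal loop. *)
Lemma closed_loop_response (Px : blkmx R T nx nx) (Pu : blkmx R T nu nx) :
  LTV Px -> LTV Pu -> (forall j, block Px j j \in unitmx) ->
  let pi := ltv_policy (Pu *m invmx Px) in
  exists y : 'cV[R]_(\sum_(i < T.+1) nx), forall t, (t <= T)%N ->
    block_row (Px *m y) t = state A B w xinit pi t /\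
    block_row (Pu *m y) t = input A B w xinit pi t.
Proof.
move=> Lx Lu Xu pi.
pose xs := @mxcol R T.+1 (fun=> nx) 1 (fun i => state A B w xinit pi i).
have xsE t : (t <= T)%N -> block_row xs t = state A B w xinit pi t.
  by move=> tT; rewrite /block_row mxcolK inordK.
exists (invmx Px *m xs) => t tT; rewrite mulKVmx ?LTV_unitmx // xsE //; split=> //.
rewrite mulmxA block_row_LTV_mul //; last exact: LTV_mul_invmx.
apply: eq_big_nat => s /andP[_]; rewrite ltnS => st.
by rewrite xsE ?nth_history // (leq_trans st).
Qed.

End ClosedLoop.

(** * Support functions, norms and quadratic costs *)

Section Bounds.
Variable R : realType.

(** Needed for the [sup] in [supp] to be an upper bound. Weights of a convex combination are at most
    1, so the sum of the absolute vertex values dominates. *)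
Lemma polytope_support_has_ubound n (S : set 'cV[R]_n) (c : 'cV[R]_n) :
  polytope S -> has_ubound [set (c^T *m w) 0 0 | w in S].
Proof.
move=> [N [v ->]]; exists (\sum_j `|(c^T *m v j) 0 0|) => _ [_ [a [a0 a1 ->]] <-].
rewrite mulmx_sumr summxE; apply: ler_sum => j _.
rewrite -scalemxAr mxE (le_trans (ler_norm _)) // normrM ger0_norm //.
rewrite ler_piMl // -a1 (bigD1 j) //= lerDl; exact: sumr_ge0.
Qed.

Lemma e_mul n m (i : 'I_n) (A : 'M[R]_(n, m)) j : ((e_ R i)^T *m A) 0 j = A i j.
Proof. by rewrite trmx_delta -rowE mxE. Qed.

(** Hoelder's inequality between the 1-norm and the maximum norm. *)
Lemma mulmx_le_l1norm n (c : 'rV[R]_n) (y : 'cV[R]_n) :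
  (forall j, `|y j 0| <= 1) -> `|(c *m y) 0 0| <= l1norm c.
Proof.
move=> y1; rewrite mxE (le_trans (ler_norm_sum _ _ _)) //.
by apply: ler_sum => j _; rewrite normrM ler_piMr.
Qed.

Lemma l2norm_sqr n (v : 'cV[R]_n) : l2norm v ^+ 2 = (v^T *m v) 0 0.
Proof.
rewrite sqr_sqrtr; last by apply: sumr_ge0 => i _; exact: sqr_ge0.
by rewrite mxE; apply: eq_bigr => i _; rewrite mxE expr2.
Qed.

Lemma mxsqrt_quad n (A : 'M[R]_n) (v : 'cV[R]_n) : psdmx A ->
  ((mxsqrt A *m v)^T *m (mxsqrt A *m v)) 0 0 = (v^T *m A *m v) 0 0.
Proof.
move=> /mxsqrtP[[Ssym _] SA].
by rewrite trmx_mul Ssym mulmxA -[_ *m mxsqrt A *m mxsqrt A]mulmxA SA.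
Qed.

Lemma blkdiag_last_quad T n (A A' : 'M[R]_n) (y : 'cV[R]__) :
  (y^T *m blkdiag_last T A A' *m y) 0 0 =
  \sum_(0 <= t < T) ((block_row y t)^T *m A *m block_row y t) 0 0 +
  ((block_row y T)^T *m A' *m block_row y T) 0 0.
Proof.
pose F i := ((block_row y i)^T *m (if i == T then A' else A) *m block_row y i) 0 0.
transitivity (\sum_(i < T.+1) F i).
  rewrite -mulmxA -{1 2}[y]mxcol_block_row mul_mxdiag_mxcol tr_mxcol mul_mxrow_mxcol summxE.
  by apply: eq_bigr => i _; rewrite /F mulmxA.
rewrite -(big_mkord predT F) big_nat_recr //= /F eqxx; congr (_ + _).
by apply: eq_big_nat => t /andP[_ tT]; rewrite (ltn_eqF tT).
Qed.

Lemma psdmx_blkdiag_last T n (A A' : 'M[R]_n) :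
  psdmx A -> psdmx A' -> psdmx (blkdiag_last T A A').
Proof.
move=> [As Ap] [As' Ap']; split.
  rewrite /blkdiag_last tr_mxdiag; apply: eq_mxdiag => i.
  by case: eqP.
by move=> x; rewrite blkdiag_last_quad addr_ge0 // sumr_ge0.
Qed.

End Bounds.

(** * Consequences of the QP constraints along a trajectory *)

Section QP.
Variables (R : realType) (nx nu T M kx ku kT : nat).
Variable p : rocp R nx nu M kx ku kT.
Variable v : qp_vars R nx nu T.

Lemma norm_le_sigma_w w i : polytope (Wset p) -> Wset p w ->
  `|w i 0| <= sigma_w p i.
Proof.
move=> polyW Ww.
have supp_le c : (c^T *m w) 0 0 <= supp (Wset p) c.
  by apply: ub_le_sup; [exact: polytope_support_has_ubound | exists w].
rewrite /sigma_w le_max; apply/orP.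
have [w0|w0] := leP 0 (w i 0); [left|right].
  by have := supp_le (e_ R i); rewrite e_mul ger0_norm.
by have := supp_le (- e_ R i); rewrite linearN /= mulNmx mxE e_mul ltr0_norm.
Qed.

(** The width of [y] is free: [y] is the identity when blocks of (a) are compared, and a column
    along a trajectory. *)
Lemma qp_affine_mul m (y : 'M[R]_(_, m)) : qp_affine p v ->
  Sig v *m y = Phx v *m y
    - downshift R T nx *m (blkdiag T (Ahat p) *m (Phx v *m y))
    - downshift R T nx *m (blkdiag T (Bhat p) *m (Phu v *m y)).
Proof.
by move=> <-; rewrite mul_row_col mulmxBl mul1mx mulNmx !mulmxBl !mulmxA.
Qed.

Lemma qp_affine_row0 m (y : 'M[R]_(_, m)) : qp_affine p v ->
  block_row (Phx v *m y) 0 = block_row (Sig v *m y) 0.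
Proof.
by move=> /qp_affine_mul ->; rewrite !block_rowB !block_row_downshift0 !subr0.
Qed.

Lemma qp_affine_rowS m (y : 'M[R]_(_, m)) t : qp_affine p v -> (t < T)%N ->
  block_row (Phx v *m y) t.+1 = block_row (Sig v *m y) t.+1
    + Ahat p *m block_row (Phx v *m y) t + Bhat p *m block_row (Phu v *m y) t.
Proof.
move=> /qp_affine_mul -> tT; rewrite !block_rowB !block_row_downshiftS //.
by rewrite !block_row_blkdiag 1?ltnW // [in RHS]addrAC !subrK.
Qed.

Variable d : nat -> 'cV[R]_nx.
Hypotheses (LPhx : LTV (Phx v)) (LPhu : LTV (Phu v)).
Hypotheses (filter_v : qp_filter v d) (affine_v : qp_affine p v).

(** In (a), the downshift brings blocks of [Phx] and [Phu] from just above the diagonal onto it, and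
    these are zero. *)
Lemma qp_Phx_diag j : block (Phx v) j j = block (Sig v) j j.
Proof.
have rowE (N : blkmx R T nx nx) i k :
    block N (inord i) k = block_col (block_row (N *m 1%:M) i) k.
  by rewrite mulmx1 block_col_row.
rewrite -(inord_val j); case: (nat_of_ord j) (ltn_ord j) => [|t] tT.
  by rewrite !rowE qp_affine_row0.
rewrite !rowE qp_affine_rowS // !mulmx1.
rewrite /block_col !submxrowD -!mul_submxrow -!/(block_col _ _) !block_col_row.
by rewrite [block (Phx v) _ _]LPhx ?[block (Phu v) _ _]LPhu
           ?inordK ?mulmx0 ?addr0 // ltnW.
Qed.

Lemma blk_Sig_diag t : (t <= T)%N -> blk (Sig v) t 0 = block (Sig v) (inord t) (inord t).
Proof. by move=> tT; rewrite -[0%N in LHS](subnn t) blkE. Qed.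

Lemma qp_Phx_diag_unit j : block (Phx v) j j \in unitmx.
Proof.
have [_ S0 Sd] := filter_v.
rewrite qp_Phx_diag -(inord_val j) -blk_Sig_diag -1?ltnS //.
case: (nat_of_ord j) (ltn_ord j) => [|t] tT; first by rewrite S0 unitmx1.
have [-> dp] := Sd t.+1 tT; rewrite unitmxE det_diag unitfE.
by apply/prodf_neq0 => i _; rewrite mxE gt_eqF.
Qed.

Section Trajectory.
Variables (y : 'cV[R]_(\sum_(i < T.+1) nx)).
Variables (DA : 'M[R]_nx) (DB : 'M[R]_(nx, nu)) (w : nat -> 'cV[R]_nx).
Let x t := block_row (Phx v *m y) t.
Let u t := block_row (Phu v *m y) t.
Let z t := block_row y t.
Hypothesis x_dyn : forall t, (t < T)%N ->
  x t.+1 = (Ahat p + DA) *m x t + (Bhat p + DB) *m u t + w t.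

Lemma lumped_disturbance0 : z 0 = x 0.
Proof.
have [LS S0 _] := filter_v.
by rewrite /x qp_affine_row0 // block_row_LTV_mul // big_nat1 S0 mul1mx.
Qed.

(** The dynamics and block row [t.+1] of (a) both express [x t.+1]; the nominal terms cancel, and
    the diagonal block [diag(d t)] isolates [z t.+1]. *)
Lemma lumped_disturbanceS t i : (t < T)%N ->
  d t i 0 * z t.+1 i 0 = (w t + DA *m x t + DB *m u t
    - \sum_(0 <= s < t.+1) blk (Sig v) t.+1 (t.+1 - s) *m z s) i 0.
Proof.
have [LS _ Sd] := filter_v => tT.
have := qp_affine_rowS y affine_v tT; rewrite -!/(x _) -!/(u _) x_dyn //.
rewrite block_row_LTV_mul // big_nat_recr //= subnn (Sd t.+1 tT).1 /= -/(z _).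
move=> E; transitivity ((diag_mx (d t)^T *m z t.+1) i 0).
  by rewrite mul_diag_mx !mxE.
move: E; rewrite !mulmxDl.
(* Once the products are generalized, the claim is linear in the entries. *)
move: (Ahat p *m _) (DA *m _) (Bhat p *m _) (DB *m _) (diag_mx _ *m _) (\sum_(_ <= _ < _) _).
by move=> a a' b b' D r /(congr1 (fun c : 'cV_nx => c i 0)); rewrite !mxE => E; lra.
Qed.

Hypothesis x_init : x 0 = x0 p.

(** The induction is strong since [z t.+1] depends on every earlier [z s]; positivity of [d t]
    allows dividing by it. *)
Lemma lumped_disturbance_le1 : polytope (Wset p) -> qp_overbound p v d ->
  Pset p (DA, DB) -> (forall t, (t < T)%N -> Wset p (w t)) ->
  forall t, (1 <= t <= T)%N -> forall i, `|z t i 0| <= 1.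
Proof.
have [_ _ Sd] := filter_v => polyW over [a [a0 a1 DE]] Ww t.
elim/ltn_ind: t => -[|t] IH //= tT i.
have d_gt0 : 0 < d t i 0 by have [_] := Sd t.+1 tT; apply.
suff : `|d t i 0 * z t.+1 i 0| <= d t i 0.
  by rewrite normrM gtr0_norm // ger_pMr.
rewrite lumped_disturbanceS //.
pose r := \sum_(0 <= s < t.+1) blk (Sig v) t.+1 (t.+1 - s) *m z s.
(* The part of the right-hand side other than [w t], at vertex [j]. As the weights sum to 1, [r] can
   be put under the convex combination. *)
pose g j := (Delta p j).1 *m x t + (Delta p j).2 *m u t - r.
have -> : w t + DA *m x t + DB *m u t - r = w t + \sum_j a j *: g j.
  have -> : DA = \sum_j a j *: (Delta p j).1.
    by rewrite -[LHS]/((DA, DB).1) DE raddf_sum.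
  have -> : DB = \sum_j a j *: (Delta p j).2.
    by rewrite -[LHS]/((DA, DB).2) DE raddf_sum.
  rewrite -!addrA; congr (_ + _); rewrite -[r in LHS]scale1r -a1 !mulmx_suml.
  rewrite scaler_suml -sumrB -big_split /=; apply: eq_bigr => j _.
  by rewrite /g scalerBr scalerDr -!scalemxAl -addrA.
have g_le j : `|g j i 0| <= d t i 0 - sigma_w p i.
  pose E s := (Delta p j).1 *m blk (Phx v) t (t - s)
    + (Delta p j).2 *m blk (Phu v) t (t - s) - blk (Sig v) t.+1 (t.+1 - s).
  have -> : g j i 0 = \sum_(0 <= s < t.+1) ((e_ R i)^T *m E s *m z s) 0 0.
    rewrite -e_mul /g /x /u /r !block_row_LTV_mul ?(ltnW tT) // !mulmx_sumr.
    rewrite -big_split -sumrB /= mulmx_sumr summxE; apply: eq_bigr => s _.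
    by rewrite -[in RHS]mulmxA /E !mulmxBl !mulmxDl !mulmxA.
  rewrite lerBrDr (le_trans _ (over j i t tT)) // -/(E 0%N).
  (* The term [s = 0] is exact because [z 0] is the initial state; the others are bounded by Hoelder
     and induction. *)
  rewrite addrAC lerD2r big_ltn // lumped_disturbance0 x_init.
  rewrite (le_trans (ler_normD _ _)) // lerD2l (le_trans (ler_norm_sum _ _ _)) //.
  rewrite !big_nat; apply: ler_sum => s /andP[s1 st]; apply: mulmx_le_l1norm.
  by apply: IH; rewrite // s1 ltnW // (leq_trans st).
(* Split the budget [d t]: [sigma_w] for the disturbance, the rest for the convex combination of the
   [g j]. *)
rewrite -[leRHS](subrKC (sigma_w p i)) mxE (le_trans (ler_normD _ _)) //.
apply: lerD; first by apply: norm_le_sigma_w => //; exact: Ww.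
rewrite summxE.
rewrite (le_trans (ler_norm_sum _ _ _)) //.
apply: (@le_trans _ _ (\sum_j a j * (d t i 0 - sigma_w p i))).
  by apply: ler_sum => j _; rewrite mxE normrM ger0_norm // ler_wpM2l.
by rewrite -mulr_suml a1 mul1r.
Qed.

(** Serves (c), (d) and (e) alike. The initial state contributes exactly; each later [z s] costs at
    most a 1-norm. *)
Lemma qp_tightenedP m n (F : 'M[R]_(m, n)) (b : 'cV[R]_m)
    (Phi : blkmx R T n nx) t :
  LTV Phi -> (t <= T)%N -> (forall t, (1 <= t <= T)%N -> forall i, `|z t i 0| <= 1) ->
  qp_tightened p F b Phi t -> polyhedron F b (block_row (Phi *m y) t).
Proof.
move=> LPhi tT z_le1 tight i.
have /= := tight _ (ex_intro2 _ _ i I erefl); rewrite trmxK; apply: le_trans.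
have -> : (F *m block_row (Phi *m y) t) i 0 =
    \sum_(0 <= s < t.+1) (row i F *m blk Phi t (t - s) *m z s) 0 0.
  rewrite block_row_LTV_mul // mulmx_sumr summxE; apply: eq_bigr => s _.
  by rewrite mulmxA -!row_mul [RHS]mxE.
rewrite [leLHS]big_ltn // subn0 lumped_disturbance0 x_init lerD2l.
rewrite !big_nat; apply: ler_sum => s /andP[s1 st].
rewrite (le_trans (ler_norm _)) // mulmx_le_l1norm //.
by apply: z_le1; rewrite s1 (leq_trans _ tT).
Qed.

Lemma nominal_lumped_disturbance_eq0 : zero_first_column v ->
  DA = 0 -> DB = 0 -> (forall t, w t = 0) ->
  forall t, (1 <= t <= T)%N -> z t = 0.
Proof.
have [_ _ Sd] := filter_v => S0 DA0 DB0 w0 t.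
elim/ltn_ind: t => -[|t] IH //= tT; apply/colP => i; rewrite [RHS]mxE.
have [_ /(_ i) /= d_gt0] := Sd t.+1 tT.
apply/(mulfI (lt0r_neq0 d_gt0)); rewrite mulr0 lumped_disturbanceS //.
(* The filter constraint removes the term in [z 0], and induction removes the others. *)
rewrite w0 DA0 DB0 !mul0mx !add0r big_ltn // subn0 S0 // mul0mx add0r.
rewrite big_nat_cond big1 ?oppr0 ?mxE // => s /andP[/andP[s1 st] _].
by rewrite IH ?mulmx0 // s1 ltnW // (leq_trans st).
Qed.

Lemma nominal_row n (Phi : blkmx R T n nx) t : LTV Phi -> (t <= T)%N ->
  (forall t, (1 <= t <= T)%N -> z t = 0) ->
  block_row (Phi *m y) t = block_row (Defs.col0 Phi *m x0 p) t.
Proof.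
move=> LPhi tT z0; rewrite block_row_LTV_mul // big_ltn //.
rewrite -[block_row y 0]/(z 0) lumped_disturbance0 x_init.
rewrite big_nat_cond big1 ?addr0 => [|s /andP[/andP[s1 st] _]]; last first.
  by rewrite -/(z s) z0 ?mulmx0 // s1 (leq_trans _ tT).
rewrite blkE // /block_row -submxcol_mul -/(block_row _ _); congr (_ *m _).
rewrite -row_col_block; congr (block_row (block_col _ _) _).
by apply: val_inj; rewrite /= inordK.
Qed.

End Trajectory.
End QP.

(** * Feasibility and cost of the synthesized controller *)

Section Performance.
Variables (R : realType) (nx nu T M kx ku kT : nat).
Variable p : rocp R nx nu M kx ku kT.

Lemma qp_costE (v : qp_vars R nx nu T) :
  psdmx (Qx p) -> psdmx (Ru p) -> psdmx (QT p) ->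
  let x := block_row (Defs.col0 (Phx v) *m x0 p) in
  let u := block_row (Defs.col0 (Phu v) *m x0 p) in
  qp_cost p v = \sum_(0 <= t < T) (((x t)^T *m Qx p *m x t) 0 0 +
                     ((u t)^T *m Ru p *m u t) 0 0) +
  ((x T)^T *m QT p *m x T) 0 0.
Proof.
move=> Qpsd Rpsd QTpsd x u.
(* The last block of the input weight is zero, so [u T] carries no cost. *)
have psd0 : psdmx (0 : 'M[R]_nu).
  by split=> [|z]; rewrite ?trmx0 // mulmx0 mul0mx mxE.
rewrite /qp_cost l2norm_sqr -[_ *m _ *m x0 p]mulmxA !mul_col_mx !mul_row_col.
rewrite !mul0mx addr0 add0r.
rewrite tr_col_mx mul_row_col mxE !mxsqrt_quad; try exact: psdmx_blkdiag_last.
by rewrite !blkdiag_last_quad -/x -/u mulmx0 mul0mx [X in _ + (_ + X)]mxE addr0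
           addrAC -big_split.
Qed.

Lemma ocp_feasible_of_qp (v : qp_vars R nx nu T) :
  polytope (Wset p) -> qp_feasible p v ->
  Phx v \in unitmx /\ ocp_feasible p (Phu v *m invmx (Phx v)).
Proof.
move=> polyW [[LPhx LPhu [d [filt aff over]]] [tightX tightT tightU]].
have unitX := qp_Phx_diag_unit LPhx LPhu filt aff.
split; [exact: LTV_unitmx|split; first exact: LTV_mul_invmx].
move=> DA DB w PD Ww x u.
have [y yP] := closed_loop_response (Ahat p + DA) (Bhat p + DB) w (x0 p) LPhx LPhu unitX.
have xE t : (t <= T)%N -> block_row (Phx v *m y) t = x t by case/yP.
have uE t : (t <= T)%N -> block_row (Phu v *m y) t = u t by case/yP.
have dyn t : (t < T)%N -> block_row (Phx v *m y) t.+1 =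
    (Ahat p + DA) *m block_row (Phx v *m y) t
    + (Bhat p + DB) *m block_row (Phu v *m y) t + w t.
  by move=> tT; rewrite xE // xE ?uE 1?ltnW // -stateS.
have init : block_row (Phx v *m y) 0 = x0 p by rewrite xE.
have y1 := lumped_disturbance_le1 LPhx LPhu filt aff dyn init polyW over PD Ww.
have tightP := qp_tightenedP filt aff init _ _ y1.
split=> [t tT|].
  rewrite -xE 1?ltnW // -uE 1?ltnW //.
  by split; apply: tightP; rewrite 1?ltnW //; [exact: tightX | exact: tightU].
by rewrite -xE //; apply: tightP.
Qed.

Lemma qp_cost_eq_JT (v : qp_vars R nx nu T) :
  psdmx (Qx p) -> psdmx (Ru p) -> psdmx (QT p) ->
  qp_feasible p v -> zero_first_column v ->
  qp_cost p v = JT T p (ltv_policy (Phu v *m invmx (Phx v))).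
Proof.
move=> Qpsd Rpsd QTpsd [[LPhx LPhu [d [filt aff _]]] _] S0.
have unitX := qp_Phx_diag_unit LPhx LPhu filt aff.
have [y yP] := closed_loop_response (Ahat p) (Bhat p) (fun=> 0) (x0 p) LPhx LPhu unitX.
(* The nominal loop, written with zero uncertainty and disturbance to fit the trajectory lemmas. *)
have dyn t : (t < T)%N -> block_row (Phx v *m y) t.+1 =
    (Ahat p + 0) *m block_row (Phx v *m y) t
    + (Bhat p + 0) *m block_row (Phu v *m y) t + 0.
  move=> tT; rewrite !addr0; have [-> _] := yP t.+1 tT.
  by have [-> ->] := yP t (ltnW tT); rewrite stateS addr0.
have init : block_row (Phx v *m y) 0 = x0 p by have [] := yP 0 isT.
have y0 := nominal_lumped_disturbance_eq0 filt aff dyn S0 erefl erefl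
  (fun=> erefl).
have rowE n (Phi : blkmx R T n nx) t (LPhi : LTV Phi) (tT : (t <= T)%N) :=
  nominal_row filt aff init LPhi tT y0.
rewrite qp_costE // /JT -!rowE // (yP T (leqnn T)).1; congr (_ + _).
apply: eq_big_nat => t /andP[_ /ltnW tT].
by rewrite -!rowE // (yP t tT).1 (yP t tT).2.
Qed.

End Performance.

Unset Implicit Arguments.
Set Strict Implicit.

Theorem theorem2 (R : realType) (nx nu T M kx ku kT : nat)
    (p : rocp R nx nu M kx ku kT)
    (T_ge1 : (1 <= T)%N) (M_ge1 : (1 <= M)%N)
    (W_polytope : polytope (Wset p)) (W_nonempty : Wset p !=set0)
    (X_compact : compact (Xset p)) (X_int : interior (Xset p) 0)
    (U_compact : compact (Uset p)) (U_int : interior (Uset p) 0)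
    (XT_compact : compact (XTset p)) (XT_int : interior (XTset p) 0)
    (Q_psd : psdmx (Qx p)) (R_pd : pdmx (Ru p)) (QT_psd : psdmx (QT p)) :
  (forall v : qp_vars R nx nu T, qp_feasible p v ->
     Phx v \in unitmx /\ ocp_feasible p (Phu v *m invmx (Phx v))) /\
  (JT_opt T p <=
     optimal_cost (@qp_cost R nx nu T M kx ku kT p)
       [set v | qp_feasible p v /\ zero_first_column v])%E.
Proof.
split=> [v|]; first exact: ocp_feasible_of_qp.
have R_psd : psdmx (Ru p).
  split=> [|u]; first exact: R_pd.1.
  have [->|/R_pd.2/ltW //] := eqVneq u 0.
  by rewrite mulmx0 mxE.
(* Each admissible QP point yields a feasible controller of equal cost, so [JT_opt] bounds every QP
   cost from below; with no such point the QP infimum is infinite. *)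
apply: le_ereal_inf_tmp => _ [v [vfeas v0] <-].
rewrite qp_cost_eq_JT //; apply: ereal_inf_lbound.
exists (Phu v *m invmx (Phx v)) => //.
by have [] := ocp_feasible_of_qp W_polytope vfeas.
Qed.
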